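(* For every integer $k\ge 1$, there are only finitely many $k$-vertex-critical $(2P_2,chair)$-free graphs.
   Context: Graphs are finite and simple, and ''finitely many'' means up to isomorphism. A graph $G$ is $k$-vertex-critical if $\chi(G)=k$ and $\chi(G-v)<k$ for all $v\in V(G)$, where $\chi$ denotes the chromatic number. A graph is $(H_1,H_2)$-free if it contains no induced subgraph isomorphic to $H_1$ or $H_2$. $2P_2$ is the disjoint union of two edges. The $chair$ is the 5-vertex tree with vertices $a,b,c,d,e$ and edges $ab, bc, cd, ce$ (i.e. a claw $K_{1,3}$ with one edge subdivided once). *)

(* Defs.v *)
From mathcomp Require Import all_boot.

Set Implicit Arguments.
Unset Strict Implicit.
Unset Printing Implicit Defensive.

Record sgraph := SGraph {
  vertex :> finType;
  adj : rel vertex;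
  adj_sym : symmetric adj;
  adj_irrefl : irreflexive adj
}.

Definition isomorphic (G H : sgraph) : Prop :=
  exists2 f : G -> H, bijective f & forall x y : G, adj (f x) (f y) = adj x y.

Section Induced.
Variables (G : sgraph) (S : {set G}).

Definition induced_adj : rel {x : G | x \in S} :=
  fun x y => adj (val x) (val y).

Lemma induced_adj_sym : symmetric induced_adj.
Proof. by move=> x y; apply: adj_sym. Qed.

Lemma induced_adj_irrefl : irreflexive induced_adj.
Proof. by move=> x; apply: adj_irrefl. Qed.

Definition induced : sgraph := SGraph induced_adj_sym induced_adj_irrefl.

End Induced.

Definition delete_vertex (G : sgraph) (v : G) : sgraph := induced [set~ v].

Definition has_induced (G H : sgraph) : Prop :=
  exists S : {set G}, isomorphic (induced S) H.

Definition free2 (H1 H2 G : sgraph) : Prop :=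
  ~ has_induced G H1 /\ ~ has_induced G H2.

Definition proper_coloring (G : sgraph) (n : nat) (f : {ffun G -> 'I_n}) : bool :=
  [forall x : G, forall y : G, adj x y ==> (f x != f y)].

Definition colorable (G : sgraph) (n : nat) : bool :=
  [exists f : {ffun G -> 'I_n}, proper_coloring f].

Lemma ex_colorable (G : sgraph) : exists n, colorable G n.
Proof.
exists #|G|; apply/existsP; exists [ffun x => enum_rank x].
apply/forallP=> x; apply/forallP=> y; apply/implyP=> xy; rewrite !ffunE.
by apply: contraTneq xy => /enum_rank_inj ->; rewrite adj_irrefl.
Qed.

Definition chromatic_number (G : sgraph) : nat := ex_minn (ex_colorable G).

Definition vertex_critical (k : nat) (G : sgraph) : Prop :=
  chromatic_number G = k /\
  forall v : G, chromatic_number (delete_vertex v) < k.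

(* Only finitely many graphs up to isomorphism satisfy P: a finite family of
   graphs represents every isomorphism class of graphs satisfying P. *)
Definition finitely_many (P : sgraph -> Prop) : Prop :=
  exists (n : nat) (F : 'I_n -> sgraph),
    forall G : sgraph, P G -> exists i : 'I_n, isomorphic G (F i).

Section EdgeList.
Variables (n : nat) (E : seq (nat * nat)).

(* Each unordered edge need only be listed in one orientation. *)
Definition edge_list_adj : rel 'I_n :=
  fun i j => (i != j) &&
    (((val i, val j) \in E) || ((val j, val i) \in E)).

Lemma edge_list_adj_sym : symmetric edge_list_adj.
Proof. by move=> i j; rewrite /edge_list_adj eq_sym orbC. Qed.

Lemma edge_list_adj_irrefl : irreflexive edge_list_adj.
Proof. by move=> i; rewrite /edge_list_adj eqxx. Qed.

Definition edge_list_graph : sgraph :=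
  SGraph edge_list_adj_sym edge_list_adj_irrefl.

End EdgeList.

Definition twoP2 : sgraph := edge_list_graph 4 [:: (0, 1); (2, 3)].

(* a, b, c, d, e = 0, 1, 2, 3, 4 *)
Definition chair : sgraph :=
  edge_list_graph 5 [:: (0, 1); (1, 2); (2, 3); (2, 4)].

(* Main.v *)
Require Import Defs.
From mathcomp Require Import all_boot.
From mathcomp Require Import zify.

(** A vertex-critical graph has no two nonadjacent vertices with nested
    neighborhoods.  Let [u], [v] lie in a stable set [S], let [c] be a neighbor
    of [u] but not of [v], and [b] a neighbor of [v] but not of [u].  Then [b]
    and [c] are adjacent because there is no induced 2P2, and they have the same
    neighbors in [S] apart from [u] and [v] because there is no induced chair.
    Fixing [v] and choosing such [c u] and [b u] for each other [u] in [S], any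
    two indices [u], [w] satisfy [c u ~ c w] or [b u ~ b w], so a large [S]
    yields, by Ramsey's theorem, a large clique.  Cliques have at most [k]
    vertices, hence stable sets are bounded, and by Ramsey's theorem again so is
    the whole graph. *)

(** Double induction: a chosen [x] splits the rest of [A] into [N] and [M], and one side still meets
    the halved bound, with [a] or [b] lowered by one. *)
Lemma ramsey (T : finType) (r : rel T) (a b : nat) (A : {set T}) :
  symmetric r -> 2 ^ (a + b) <= #|A| ->
  exists2 K : {set T}, K \subset A &
    (#|K| = a /\ {in K &, forall x y, x != y -> r x y}) \/
    (#|K| = b /\ {in K &, forall x y, x != y -> ~~ r x y}).
Proof.
move=> rC; elim: a b A => [|a IHa] b A.
  by exists set0; [exact: sub0set | left; split=> [|x y]; rewrite ?cards0 ?inE].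
elim: b A => [|b IHb] A leA.
  by exists set0; [exact: sub0set | right; split=> [|x y]; rewrite ?cards0 ?inE].
have /set0Pn[x xA] : A != set0.
  by rewrite -card_gt0 (leq_trans _ leA) // expn_gt0.
set N := [set y in A :\ x | r x y]; set M := [set y in A :\ x | ~~ r x y].
have cardNM : #|A| = (#|N| + #|M|).+1.
  rewrite (cardsD1 x) xA -(cardsID [set y | r x y] (A :\ x)); congr (_ + _).+1.
    by apply: eq_card => y; rewrite !inE.
  by apply: eq_card => y; rewrite !inE andbC.
(* Stated for an arbitrary [p], so that it serves both [r] and its negation. *)
have extend (B K : {set T}) (p : rel T) : symmetric p ->
    B \subset A :\ x -> {in B, forall y, p x y} -> K \subset B ->
    {in K &, forall y z, y != z -> p y z} ->
    [/\ x |: K \subset A, #|x |: K| = #|K|.+1 &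
        {in x |: K &, forall y z, y != z -> p y z}].
  move=> pC /subsetP sB pB /subsetP sK pK; split.
  - apply/subsetP=> y /setU1P[-> //|/sK/sB].
    by rewrite !inE => /andP[].
  - rewrite cardsU1; have -> // : x \notin K.
    by apply/negP=> /sK/sB; rewrite !inE eqxx.
  - move=> y z /setU1P[->|yK] /setU1P[->|zK]; rewrite ?eqxx //.
    + by move=> _; apply/pB/sK.
    + by move=> _; rewrite pC; apply/pB/sK.
    + exact: pK.
have sNA : N \subset A :\ x by apply/subsetP=> y; rewrite inE => /andP[].
have sMA : M \subset A :\ x by apply/subsetP=> y; rewrite inE => /andP[].
have [leN|ltN] := leqP (2 ^ (a + b.+1)) #|N|.
  have [K sK [[cK rK]|[cK rK]]] := IHa _ _ leN.
    have [|sK' cK' rK'] := extend N K r rC sNA _ sK rK.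
      by move=> y; rewrite inE => /andP[].
    by exists (x |: K) => //; left; rewrite cK' cK.
  by exists K; [exact: subset_trans (subset_trans sK sNA) (subsetDl _ _) | right].
have leM : 2 ^ (a.+1 + b) <= #|M|.
  have -> : a.+1 + b = a + b.+1 by rewrite addSnnS.
  (* The strict bound on [N] pays for the removal of [x]. *)
  by move: leA ltN; rewrite cardNM addSn expnS; lia.
have [K sK [[cK rK]|[cK rK]]] := IHb _ leM.
  by exists K; [exact: subset_trans (subset_trans sK sMA) (subsetDl _ _) | left].
have [||sK' cK' rK'] := extend M K (fun y z => ~~ r y z) _ sMA _ sK rK.
- by move=> y z; rewrite rC.
- by move=> y; rewrite inE => /andP[].
by exists (x |: K) => //; right; rewrite cK' cK.
Qed.

Lemma has_induced_inj (G H : sgraph) (f : H -> G) :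
  injective f -> (forall x y, adj (f x) (f y) = adj x y) -> has_induced G H.
Proof.
move=> f_inj f_adj; pose S := f @: [set: H]; exists S.
have fS x : f x \in S by apply: imset_f; rewrite inE.
pose h (x : H) : induced S := Sub (f x) (fS x).
have h_inj : injective h by move=> x y /(congr1 val)/f_inj.
have h_bij : bijective h.
  apply: inj_card_bij => //; rewrite card_sig.
  rewrite (eq_card (B := mem S)) ?card_imset ?cardsT //.
have [g hK gK] := h_bij.
exists g => [|x y]; first by exists h.
by rewrite -[in RHS](gK x) -[in RHS](gK y) -f_adj.
Qed.

Lemma adj_neq {G : sgraph} {x y z : G} : adj x z -> ~~ adj y z -> x != y.
Proof. by move=> xz; apply: contraNneq => <-. Qed.

Lemma clique_bound (G : sgraph) (n : nat) (K : {set G}) :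
  colorable G n -> {in K &, forall x y, x != y -> adj x y} -> #|K| <= n.
Proof.
case/existsP=> f /forallP fP cK; rewrite -[n]card_ord.
rewrite -(@card_in_imset _ _ f) ?max_card // => x y xK yK fxy.
apply/eqP/negPn/negP=> neq_xy.
by have /forallP/(_ y) := fP x; rewrite cK // fxy eqxx.
Qed.

(** If every neighbor of [u] were a neighbor of [v], an optimal coloring of [G] minus [u] would
    extend to [G] by giving [u] the color of [v], against criticality. *)
Lemma critical_incomparable (k : nat) (G : sgraph) (u v : G) :
  vertex_critical k G -> u != v -> ~~ adj u v ->
  exists2 c, adj u c & ~~ adj v c.
Proof.
move=> [chiG crit] uv nuv.
have [/existsP[c /andP[uc vc]]|/existsPn sub_uv] :=
  boolP [exists c, adj u c && ~~ adj v c]; first by exists c.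
have {}sub_uv x : adj u x -> adj v x.
  by move=> ux; have := sub_uv x; rewrite ux /= negbK.
have := crit u; rewrite -chiG {1}/chromatic_number.
case: ex_minnP => n /existsP[f /forallP fP] _; rewrite ltnNge => /negP[].
rewrite /chromatic_number; case: ex_minnP => m _; apply.
(* Folding [u] onto [v] is a homomorphism from [G] to [G] minus [u], by [sub_uv]. *)
pose r (x : G) := if x == u then v else x.
have rP x : r x \in [set~ u].
  by rewrite /r !inE; case: (eqVneq x u) => [_|]; rewrite 1?eq_sym.
apply/existsP; exists [ffun x => f (Sub (r x) (rP x))].
apply/forallP=> x; apply/forallP=> y; apply/implyP=> xy; rewrite !ffunE.
have /forallP/(_ (Sub (r y) (rP y)))/implyP := fP (Sub (r x) (rP x)).
apply; rewrite /adj /= /induced_adj /= /r.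
case: eqP xy => [->|_]; case: eqP => [->|_] //; rewrite ?adj_irrefl //.
- exact: sub_uv.
- by rewrite ![adj x _]adj_sym; apply: sub_uv.
Qed.

Section Exchange.
Variable G : sgraph.
Hypothesis G_free : free2 twoP2 chair G.

(** Of the four pairs between the edges [uc] and [ab], only [bc] is left to prevent an induced
    2P2. *)
Lemma twoP2_free_adj (u c a b : G) :
  adj u c -> adj a b -> ~~ adj u a -> ~~ adj u b -> ~~ adj a c -> adj b c.
Proof.
move=> uc ab nua nub nac; apply/negPn/negP=> nbc; case: G_free => noP2 _.
have [cu ba nca nbu] : [/\ adj c u, adj b a, ~~ adj c a & ~~ adj b u].
  by rewrite (adj_sym c) (adj_sym b) (adj_sym c) (adj_sym b u).
have nau : ~~ adj a u by rewrite adj_sym.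
have ncb : ~~ adj c b by rewrite adj_sym.
have s_uniq : uniq [:: u; c; a; b].
  rewrite /= !inE !negb_or !andbT (adj_neq uc) ?adj_irrefl //.
  rewrite (adj_neq uc nac) (adj_neq uc nbc) (adj_neq cu nau) (adj_neq cu nbu).
  by rewrite (adj_neq ab) ?adj_irrefl.
apply: noP2; apply: (has_induced_inj G twoP2 (fun i : 'I_4 => nth u [:: u; c; a; b] i)).
  by move=> i j /eqP; rewrite nth_uniq // => /eqP/val_inj.
by case=> [[|[|[|[|//]]]] ?] [[|[|[|[|//]]]] ?] /=;
  rewrite ?adj_irrefl; apply/idP/idP=> //; apply/negP.
Qed.

(** If [b] missed [w], the path [v], [b], [c] with the leaves [u] and [w] at [c] would be an induced
    chair. *)
Lemma exchange_sub (u v w b c : G) :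
  ~~ adj u v -> ~~ adj u w -> ~~ adj v w -> w != u ->
  adj u c -> ~~ adj v c -> adj v b -> ~~ adj u b -> adj c w -> adj b w.
Proof.
move=> nuv nuw nvw wu uc nvc vb nub cw; apply/negPn/negP=> nbw.
have bc := twoP2_free_adj _ _ _ _ uc vb nuv nub nvc.
case: G_free => _; apply.
have [bv wu' nwb nwv] : [/\ adj b v, u != w, ~~ adj w b & ~~ adj w v].
  by rewrite adj_sym eq_sym (adj_sym w b) (adj_sym w v).
have s_uniq : uniq [:: v; b; c; u; w].
  rewrite /= !inE !negb_or !andbT wu' [v == c]eq_sym.
  rewrite (adj_neq vb) ?adj_irrefl // (adj_neq cw nvw) (adj_neq vb nub).
  rewrite (adj_neq vb nwb) (adj_neq bc) ?adj_irrefl // (adj_neq bv nuv).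
  by rewrite (adj_neq bv nwv) (adj_neq cw nuw) (adj_neq cw) ?adj_irrefl.
apply: (has_induced_inj G chair (fun i : 'I_5 => nth u [:: v; b; c; u; w] i)).
  by move=> i j /eqP; rewrite nth_uniq // => /eqP/val_inj.
have tree := (vb, bc, cw, negPf nvc, negPf nub, negPf nbw, negPf nuw).
have tree' := (negPf nvw, negPf nuv, uc).
by case=> [[|[|[|[|[|//]]]]] ?] [[|[|[|[|[|//]]]]] ?] /=;
  first [by rewrite adj_irrefl | by rewrite ?tree ?tree'
        | by rewrite [LHS]adj_sym ?tree ?tree'].
Qed.

(** The configuration is symmetric under swapping the pair [u], [c] with the pair [v], [b]. *)
Lemma exchange (u v w b c : G) :
  ~~ adj u v -> ~~ adj u w -> ~~ adj v w -> w != u -> w != v ->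
  adj u c -> ~~ adj v c -> adj v b -> ~~ adj u b -> adj c w = adj b w.
Proof.
move=> nuv nuw nvw wu wv uc nvc vb nub; have nvu : ~~ adj v u by rewrite adj_sym.
apply/idP/idP.
  exact: (exchange_sub _ _ _ _ _ nuv nuw nvw wu uc nvc vb nub).
exact: (exchange_sub _ _ _ _ _ nvu nvw nuw wv vb nub uc nvc).
Qed.

Lemma clique_of_stable (m : nat) (S : {set G}) :
  (forall u v : G, u != v -> ~~ adj u v -> exists2 c, adj u c & ~~ adj v c) ->
  {in S &, forall x y, x != y -> ~~ adj x y} -> 2 ^ (m + m) < #|S| ->
  exists2 K : {set G}, #|K| = m & {in K &, forall x y, x != y -> adj x y}.
Proof.
move=> incomp stS ltS.
have /card_gt0P[v vS] : 0 < #|S| by apply: leq_ltn_trans ltS.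
pose A := S :\ v.
have AP x : x \in A -> [/\ x \in S, x != v, ~~ adj x v & ~~ adj v x].
  by rewrite !inE => /andP[xv xS]; split=> //; apply: stS; rewrite // eq_sym.
(* The choice functions are total; their value [v] outside [A] is a dummy. *)
have [c cP] : exists c : G -> G, forall u, u \in A -> adj u (c u) /\ ~~ adj v (c u).
  apply: (fin_all_exists (P := fun u x => u \in A -> adj u x /\ ~~ adj v x)) => u.
  case: (boolP (u \in A)) => [/AP[uS uv nuv nvu]|_]; last by exists v.
  by have [x] := incomp _ _ uv nuv; exists x.
have [b bP] : exists b : G -> G, forall u, u \in A -> adj v (b u) /\ ~~ adj u (b u).
  apply: (fin_all_exists (P := fun u x => u \in A -> adj v x /\ ~~ adj u x)) => u.
  case: (boolP (u \in A)) => [/AP[uS uv nuv nvu]|_]; last by exists v.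
  by rewrite eq_sym in uv; have [x] := incomp _ _ uv nvu; exists x.
(* Since [v] is fixed, [b w] can stand in for [b u] in the exchange as soon as it misses [u]. *)
have cb u w x : u \in A -> w \in A -> x \in A -> x != u -> ~~ adj u (b w) ->
    adj x (c u) = adj x (b w).
  move=> uA wA xA xu nubw; have [[uc nvc] [vb _]] := (cP u uA, bP w wA).
  have [[uS uv nuv _] [xS xv _ nvx]] := (AP u uA, AP x xA).
  rewrite ![adj x _]adj_sym (exchange u v x (b w)) //.
  by apply: stS; rewrite // eq_sym.
have cc_or_bb u w : u \in A -> w \in A -> u != w ->
    adj (c u) (c w) || adj (b u) (b w).
  move=> uA wA uw; have wu : w != u by rewrite eq_sym.
  have [[uc nvcu] [vbu nubu]] := (cP u uA, bP u uA).
  have [[wc nvcw] [vbw nwbw]] := (cP w wA, bP w wA).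
  have [[uS _ _ _] [wS _ _ _]] := (AP u uA, AP w wA).
  have [nuw nwu] : ~~ adj u w /\ ~~ adj w u by split; apply: stS.
  have := cb u u w uA uA wA wu nubu; have := cb w w u wA wA uA uw nwbw.
  case: (boolP (adj u (b w))) => ubw ucw; case: (boolP (adj w (b u))) => wbu wcu.
  - by rewrite (twoP2_free_adj u (b w) w (b u)) ?orbT.
  - have := cb w u u wA uA uA uw wbu; by rewrite ucw (negPf nubu).
  - have := cb u w w uA wA wA wu ubw; by rewrite wcu (negPf nwbw).
  - by rewrite (twoP2_free_adj w (c w) u (c u)) ?wcu ?ucw.
have leA : 2 ^ (m + m) <= #|A| by move: ltS; rewrite (cardsD1 v) vS.
have image_clique (K : {set G}) (f : G -> G) : #|K| = m ->
    {in K &, forall x y, x != y -> adj (f x) (f y)} ->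
    exists2 L : {set G}, #|L| = m & {in L &, forall x y, x != y -> adj x y}.
  move=> cK fK; exists (f @: K).
    (* Distinct indices with equal images would give a vertex adjacent to itself. *)
    rewrite card_in_imset // => x y xK yK fxy; apply/eqP/negPn/negP=> xy.
    by have := fK x y xK yK xy; rewrite fxy adj_irrefl.
  move=> _ _ /imsetP[x xK ->] /imsetP[y yK ->] fxy; apply: fK => //.
  by apply: contraNneq fxy => ->.
(* Ramsey is applied to the indices in [A], with adjacency pulled back along [c]; a set without such
   pairs is a clique under [b]. *)
have rC : symmetric (fun u w => adj (c u) (c w)) by move=> u w; apply: adj_sym.
have [K /subsetP sK [[cK rK]|[cK rK]]] := ramsey G _ m m A rC leA.
  exact: (image_clique K c).
apply: (image_clique K b) => // x y xK yK xy.
by have := cc_or_bb x y (sK x xK) (sK y yK) xy; rewrite (negPf (rK x y xK yK xy)).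
Qed.

End Exchange.

(** Numbering its vertices encodes each such graph, up to isomorphism, by its order and a set of
    pairs below [N]; these codes form the finite type [C]. *)
Lemma finitely_many_card (P : sgraph -> Prop) (N : nat) :
  (forall G, P G -> #|G| <= N) -> finitely_many P.
Proof.
move=> PN; pose C := ('I_N.+1 * {set 'I_N * 'I_N})%type.
pose F (x : C) := edge_list_graph x.1 [seq (val p.1, val p.2) | p <- enum x.2].
exists #|{: C}|, (fun i => F (enum_val i)) => G /PN leG.
have ltG : #|G| < N.+1 by [].
pose rk (x : G) : 'I_N := widen_ord leG (enum_rank x).
have rkE (x y : G) : val (enum_rank x) = val (rk y) -> x = y.
  by move=> /ord_inj; apply: enum_rank_inj.
pose E := [set p : 'I_N * 'I_N |
  [exists x : G, exists y : G, adj x y && (p == (rk x, rk y))]].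
pose code : C := (Ordinal ltG, E).
exists (enum_rank code); rewrite enum_rankK.
have edgesE (x y : G) : ((val (enum_rank x), val (enum_rank y)) \in
    [seq (val p.1, val p.2) | p <- enum E]) = adj x y.
  apply/mapP/idP => [[[i j]]|xy].
    rewrite mem_enum inE => /existsP[x' /existsP[y' /andP[xy /eqP[-> ->]]]].
    by move=> /pair_equal_spec[/rkE -> /rkE ->].
  exists (rk x, rk y); last by [].
  rewrite mem_enum inE.
  by apply/existsP; exists x; apply/existsP; exists y; rewrite xy eqxx.
exists (enum_rank : G -> F code) => [|x y]; first exact: enum_rank_bij.
rewrite /F /= /edge_list_adj !edgesE (inj_eq enum_rank_inj) [adj y x]adj_sym orbb.
by case: eqP => [->|]; rewrite ?adj_irrefl.
Qed.

Theorem corollary4p3 (k : nat) (hk : 1 <= k) :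
  finitely_many (fun G : sgraph => vertex_critical k G /\ free2 twoP2 chair G).
Proof.
(* The least size of a stable set from which [clique_of_stable] yields a clique on [k.+1] vertices;
   the outer successor meets its strict inequality. *)
pose s := (2 ^ (k.+1 + k.+1)).+1.
apply: (@finitely_many_card _ (2 ^ (k.+1 + s))) => G [critG freeG].
have colG : colorable G k by rewrite -critG.1 /chromatic_number; case: ex_minnP.
have no_clique (K : {set G}) :
    #|K| = k.+1 -> ~ {in K &, forall x y, x != y -> adj x y}.
  by move=> cK /(clique_bound G k K colG); rewrite cK ltnn.
rewrite leqNgt; apply/negP=> /ltnW ltG; rewrite -cardsT in ltG.
have [K _ [[cK rK]|[cK rK]]] := ramsey G _ k.+1 s _ (@adj_sym G) ltG.
  exact: (no_clique K).
have incomp (u v : G) := critical_incomparable k G u v critG.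
have [|L cL] := clique_of_stable G freeG k.+1 K incomp rK; first by rewrite cK.
exact: no_clique.
Qed.
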